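(* Let $\lambda$ be a nonnegative integer and let $G$ be a finite connected $\lambda$-edge-connected graph. Then either $G^2$ is maximally edge-connected, or \[ \lambda(G^2) \geq \frac{1}{2}\lambda^{3/2} - \frac{1}{2}\lambda. \]
   Context: All graphs are finite and simple. A graph is $\lambda$-edge-connected if it cannot be disconnected by removing fewer than $\lambda$ edges. The square $G^2$ of $G$ is the graph on $V(G)$ in which two distinct vertices are adjacent if and only if their distance in $G$ is at most $2$. $\lambda(H)$ denotes the edge-connectivity of $H$ (minimum number of edges whose removal disconnects $H$). A graph is maximally edge-connected if its edge-connectivity equals its minimum degree. *)

(* Defs.v *)
From mathcomp Require Import all_boot.

Set Implicit Arguments.
Unset Strict Implicit.
Unset Printing Implicit Defensive.

Record sgraph := SGraph {
  vertex :> finType;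
  adj : rel vertex;
  adj_sym : symmetric adj;
  adj_irr : irreflexive adj }.

Definition edges (G : sgraph) : {set {set G}} :=
  [set [set p.1; p.2] | p : G * G & adj p.1 p.2].

Definition deg (G : sgraph) (x : G) : nat := #|[set y | adj x y]|.

(* The default value #|G| exceeds every degree, so it only matters for the
   empty graph, where it gives 0. *)
Definition min_deg (G : sgraph) : nat := \big[minn/#|G|]_(x : G) deg x.

(* The empty graph is not connected. *)
Definition connected (G : sgraph) : bool :=
  (0 < #|G|) && [forall x : G, forall y : G, connect (@adj G) x y].

Section DelEdges.
Variables (G : sgraph) (F : {set {set G}}).

Definition del_adj : rel G :=
  [rel x y | adj x y && ([set x; y] \notin F)].

Lemma del_adj_sym : symmetric del_adj.
Proof. by move=> x y; rewrite /del_adj /= adj_sym setUC. Qed.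

Lemma del_adj_irr : irreflexive del_adj.
Proof. by move=> x; rewrite /del_adj /= adj_irr. Qed.

Definition del_edges : sgraph := SGraph del_adj_sym del_adj_irr.
End DelEdges.

Definition edge_connected (k : nat) (G : sgraph) : Prop :=
  forall F : {set {set G}},
    F \subset edges G -> #|F| < k -> connected (del_edges F).

(* If G has at least two vertices, then removing all edges disconnects it, so
   the default value #|edges G| does not affect the minimum.  If G has exactly
   one vertex, then no set of edges disconnects it, and the default value gives
   the usual convention that its edge-connectivity is 0. *)
Definition edge_connectivity (G : sgraph) : nat :=
  \big[minn/#|edges G|]_(F : {set {set G}} |
      (F \subset edges G) && ~~ connected (del_edges F)) #|F|.

Definition maximally_edge_connected (G : sgraph) : Prop :=
  edge_connectivity G = min_deg G.

Section Distance.
Variable G : sgraph.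

Definition walk (x y : G) (k : nat) : bool :=
  [exists p : k.-tuple G, path (@adj G) x p && (last x p == y)].

Lemma connect_walk (x y : G) : connect (@adj G) x y -> exists k, walk x y k.
Proof.
case/connectP=> p px ->; exists (size p).
by apply/existsP; exists (in_tuple p); rewrite /= px eqxx.
Qed.

Lemma walk_sym (x y : G) (k : nat) : walk x y k = walk y x k.
Proof.
suff H u v : walk u v k -> walk v u k by apply/idP/idP; apply: H.
case/existsP=> p /andP[pp /eqP <-]; apply/existsP.
have sz : size (rev (belast u p)) == k by rewrite size_rev size_belast size_tuple.
exists (Tuple sz); rewrite /= rev_path.
rewrite (eq_path (e' := @adj G)) ?pp /=; last by move=> a b; rewrite adj_sym.
by case: (tval p) => //= a s; rewrite rev_cons last_rcons.
Qed.

(* [None] stands for infinite distance. *)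
Definition dist (x y : G) : option nat :=
  match @idP (connect (@adj G) x y) with
  | ReflectT xy => Some (ex_minn (connect_walk xy))
  | ReflectF _ => None
  end.

Definition dist_le (k : nat) (x y : G) : bool :=
  if dist x y is Some d then d <= k else false.

Lemma dist_leP (k : nat) (x y : G) :
  reflect (exists2 d, d <= k & walk x y d) (dist_le k x y).
Proof.
rewrite /dist_le /dist; case: {-}_ / idP => [xy | nxy].
  case: ex_minnP => m wm min_m; apply: (iffP idP) => [mk | [d dk wd]].
    by exists m.
  exact: leq_trans (min_m d wd) dk.
apply: ReflectF => -[d _ /existsP[p /andP[pp /eqP py]]]; case: nxy.
by apply/connectP; exists p.
Qed.

Lemma dist_le_sym (k : nat) : symmetric (dist_le k).
Proof.
by move=> x y; apply/dist_leP/dist_leP => -[d dk w]; exists d;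
  rewrite // walk_sym.
Qed.

Definition square_adj : rel G := [rel x y | (x != y) && dist_le 2 x y].

Lemma square_adj_sym : symmetric square_adj.
Proof. by move=> x y; rewrite /square_adj /= eq_sym dist_le_sym. Qed.

Lemma square_adj_irr : irreflexive square_adj.
Proof. by move=> x; rewrite /square_adj /= eqxx. Qed.

Definition square : sgraph := SGraph square_adj_sym square_adj_irr.
End Distance.

(* Main.v *)
(* Let (A, B) be a cut of the square crossed by c edges, with c smaller than the
   minimum degree of the square.  Call v good if at least lambda / 2 edges of the
   square at v cross the cut, and flipped if already lambda / 2 edges of G at v do.
   Moving the flipped vertices to the other side yields a cut of G all of whose
   edges join two good vertices:
   - if vw crosses (A, B), then v sees w and all the neighbours of w on the side
     of w, so that v is good unless w is flipped;
   - if vw does not cross (A, B) and v is flipped, then w sees the neighbours of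
     v across, so w is good.
   The new cut is nontrivial, because each side of a cut with c small contains a
   vertex without neighbours across, which is not flipped.  With s and t good
   vertices on its two sides, lambda <= s t <= (s + t)^2 / 4.  Counting crossing
   edges at good vertices gives (s + t) lambda / 2 <= 2 c, and together
   lambda^3 <= 4 c^2. *)
Require Import Defs.
From mathcomp Require Import all_boot all_order all_algebra.
From mathcomp Require Import reals exp.
From mathcomp Require Import zify lra.
Import GRing.Theory Num.Theory.
Local Open Scope ring_scope.

(** * Vertex cuts, disconnecting edge sets and degrees *)

Definition crossing (G : sgraph) (A : {set G}) : {set G * G} :=
  [set p | [&& p.1 \in A, p.2 \notin A & adj p.1 p.2]].

Definition cut_edges (G : sgraph) (A : {set G}) : {set {set G}} :=
  [set [set p.1; p.2] | p in crossing G A].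

Definition cross_nbrs (G : sgraph) (A : {set G}) (v : G) : {set G} :=
  [set w | ((w \in A) != (v \in A)) && adj v w].

Definition side_nbrs (G : sgraph) (A : {set G}) (v : G) : {set G} :=
  [set w | ((w \in A) == (v \in A)) && adj v w].

Lemma bigminn_le_cond (I : finType) (d : nat) (P : pred I) (F : I -> nat) (i : I) :
  P i -> (\big[minn/d]_(j | P j) F j <= F i)%N.
Proof.
move=> Pi; have := mem_index_enum i; elim: (index_enum I) => // j r IH.
rewrite inE big_cons => /predU1P[<-|/IH le_i]; first by rewrite Pi geq_minl.
by case: ifP => // _; apply: leq_trans (geq_minr _ _) le_i.
Qed.

Section Cuts.
Local Open Scope nat_scope.
Variable G : sgraph.
Implicit Types (A : {set G}) (F : {set {set G}}) (x y v w : G).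

Lemma deg_split A v : deg v = #|side_nbrs G A v| + #|cross_nbrs G A v|.
Proof.
rewrite /deg -(cardsID [set w | (w \in A) == (v \in A)]); congr (_ + _).
  by apply: eq_card => w; rewrite !inE andbC.
by apply: eq_card => w; rewrite !inE.
Qed.

Lemma cut_edges_sub A : cut_edges G A \subset edges G.
Proof.
apply/subsetP=> e /imsetP[p + ->]; rewrite inE => /and3P[_ _ pp].
by apply/imsetP; exists p; rewrite // inE.
Qed.

Lemma cut_edges_disconnect A :
  A != set0 -> A != setT -> ~~ connected (del_edges (cut_edges G A)).
Proof.
move=> /set0Pn[x xA]; rewrite -subTset => /subsetPn[y _ yA].
apply/negP=> /andP[_ /forallP/(_ x)/forallP/(_ y) /= cxy].
(* After the deletion no remaining edge leaves [A], so [x] cannot reach [y]. *)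
have cl : fingraph.closed (del_adj (cut_edges G A)) (mem A).
  move=> u v /= /andP[uv]; apply: contraNeq.
  case uA: (u \in A); case vA: (v \in A) => // _.
    by apply/imsetP; exists (u, v); rewrite // inE /= uA vA.
  by apply/imsetP; exists (v, u); rewrite /= 1?setUC // inE /= uA vA adj_sym.
by move: yA; rewrite -(closed_connect cl cxy) xA.
Qed.

Lemma edge_connected_crossing k A :
  edge_connected k G -> A != set0 -> A != setT -> k <= #|crossing G A|.
Proof.
move=> Gk A0 AT; rewrite leqNgt; apply/negP=> lt_k.
move/negP: (cut_edges_disconnect A A0 AT); apply.
by apply: Gk; [exact: cut_edges_sub | exact: leq_ltn_trans (leq_imset_card _ _) lt_k].
Qed.

Lemma crossing1 v : #|crossing G [set v]| <= deg v.
Proof.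
rewrite /deg -(card_in_imset (f := fun w => (v, w))); last by move=> ? ? _ _ [].
apply/subset_leq_card/subsetP=> -[u w]; rewrite !inE /= => /and3P[/eqP-> _ vw].
by apply/imsetP; exists w; rewrite ?inE.
Qed.

Lemma set1_neqT v : 1 < #|G| -> [set v] != setT.
Proof. by apply: contraTneq => /(congr1 (fun B : {set G} => #|B|)); rewrite cards1 cardsT => <-. Qed.

Lemma set1_neq0 v : [set v] != set0.
Proof. by apply/set0Pn; exists v; rewrite inE. Qed.

Lemma edge_connected_deg k v : edge_connected k G -> 1 < #|G| -> k <= deg v.
Proof.
move=> Gk G2; apply: leq_trans (crossing1 v).
exact: edge_connected_crossing Gk (set1_neq0 v) (set1_neqT v G2).
Qed.

(** The vertices still reachable from some [x] after deleting [F] form a cut, and every edge leaving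
    it belongs to [F]. *)
Lemma disconnected_cut F : 0 < #|G| -> ~~ connected (del_edges F) ->
  exists A, [/\ A != set0, A != setT & #|crossing G A| <= #|F|].
Proof.
move=> G0; rewrite /connected G0 /= => /forallPn[x /forallPn[y nxy]].
pose A : {set G} := [set z | connect (del_adj F) x z]; exists A.
split; first by apply/set0Pn; exists x; rewrite inE connect0.
  by apply: contraNneq nxy => /setP/(_ y); rewrite !inE.
rewrite -(card_in_imset (f := fun p => [set p.1; p.2])).
  apply/subset_leq_card/subsetP=> _ /imsetP[[u w] + ->] /=.
  rewrite !inE /= => /and3P[xu nxw uw]; apply: contraNT nxw => uwF.
  by apply: connect_trans xu _; apply: connect1; exact/andP.
(* Pairs are oriented out of [A], so an edge determines its pair: a swap would put a vertex both
   inside and outside [A]. *)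
case=> [a b] [c d]; rewrite !inE /= => /and3P[aA bA _] /and3P[cA dA _] e.
have := set21 a b; have := set22 a b; rewrite e !inE.
case/orP=> /eqP Eb; first by rewrite Eb cA in bA.
by case/orP=> /eqP Ea; [rewrite Ea Eb | rewrite Ea (negPf dA) in aA].
Qed.

Lemma crossing_setC A : #|crossing G (~: A)| = #|crossing G A|.
Proof.
rewrite -(card_in_imset (f := fun p => (p.2, p.1)) (D := mem (crossing G A)));
  last by move=> [a b] [c d] _ _ /= [-> ->].
apply: eq_card => -[a b]; rewrite !inE /= negbK; apply/idP/imsetP.
  by case/and3P=> aA bA ab; exists (b, a); rewrite ?inE //= bA aA adj_sym.
by case=> -[c d]; rewrite !inE /= => /and3P[cA dA cd] [-> ->]; rewrite cA dA adj_sym.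
Qed.

Lemma in_crossing A v w :
  ((v, w) \in crossing G A) = [&& v \in A, w \notin A & adj v w].
Proof. by rewrite inE. Qed.

Lemma card_crossing A : #|crossing G A| = \sum_(v in A) #|cross_nbrs G A v|.
Proof.
rewrite -sum1_card (partition_big (fun p : G * G => p.1) (mem A)) /=; last first.
  by move=> p; rewrite inE; case/and3P.
apply: eq_bigr => v vA; rewrite sum1_card.
rewrite -[RHS](card_in_imset (f := fun w => (v, w))); last by move=> ? ? _ _ [].
apply: eq_card => -[u w]; rewrite unfold_in /= !inE /=; apply/idP/imsetP.
  by case/andP=> /and3P[uA wA uw] /eqP <-; exists w; rewrite // inE uA (negPf wA).
case=> w'; rewrite !inE vA => /andP[/negPf w'A vw'] [-> ->].
by rewrite vA vw' eqxx; case: (w' \in A) w'A.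
Qed.

Lemma sum_cross_nbrs A : \sum_v #|cross_nbrs G A v| = 2 * #|crossing G A|.
Proof.
rewrite (bigID (mem A)) /= -card_crossing mul2n -addnn; congr (_ + _).
rewrite -crossing_setC card_crossing; apply: eq_big => [v | v vA]; rewrite ?inE //.
by apply: eq_card => w; rewrite !inE; do 2 case: (_ \in A).
Qed.

Lemma min_deg_le v : min_deg G <= deg v.
Proof. exact: bigminn_le_cond. Qed.

(* If every vertex of A had a neighbour across, the crossing edges at the other
   vertices of A would make up for the neighbours of a fixed v inside A. *)
Lemma small_cut_deep_vertex A : A != set0 -> #|crossing G A| < min_deg G ->
  exists2 v, v \in A & #|cross_nbrs G A v| = 0.
Proof.
case/set0Pn=> x xA cut.
have [/existsP[v /andP[vA /eqP v0]]|] :=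
  boolP [exists v, (v \in A) && (#|cross_nbrs G A v| == 0)]; first by exists v.
rewrite negb_exists => /forallP no.
suff: deg x <= #|crossing G A| by rewrite leqNgt (leq_trans cut (min_deg_le x)).
rewrite card_crossing (bigD1 x) //= addnC (deg_split A x) leq_add2r.
apply: (@leq_trans #|A :\ x|).
  apply/subset_leq_card/subsetP=> w; rewrite !inE xA => /andP[/eqP-> xw].
  by rewrite andbT; apply: contraTneq xw => ->; rewrite adj_irr.
rewrite -sum1_card (eq_bigl (fun v => (v \in A) && (v != x))); last first.
  by move=> v; rewrite !inE andbC.
by apply: leq_sum => v /andP[vA _]; move: (no v); rewrite vA lt0n.
Qed.

Lemma edge_connectivity_le F :
  F \subset edges G -> ~~ connected (del_edges F) -> edge_connectivity G <= #|F|.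
Proof.
by move=> sF nF; apply: bigminn_le_cond; rewrite sF.
Qed.

Lemma edge_connectivity_le_min_deg : 1 < #|G| -> edge_connectivity G <= min_deg G.
Proof.
move=> G2; have le_deg v : edge_connectivity G <= deg v.
  apply: leq_trans (crossing1 v).
  apply: leq_trans (leq_imset_card (fun p => [set p.1; p.2]) _).
  apply: edge_connectivity_le (cut_edges_sub _) _.
  exact: cut_edges_disconnect (set1_neq0 v) (set1_neqT v G2).
rewrite /min_deg; elim/big_ind: _ => [|m n lem len|//]; last by rewrite leq_min lem.
(* The default value [#|G|] of the minimum has to be bounded too; it exceeds any degree. *)
have /card_gt0P[v _] : 0 < #|G| by apply: ltnW.
exact: leq_trans (le_deg v) (max_card _).
Qed.

(** Shows that the default value [#|edges G|] in [edge_connectivity] is itself the size of a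
    disconnecting set. Deleting all edges leaves no more connections than deleting those at one
    vertex. *)
Lemma edges_disconnect : 1 < #|G| -> ~~ connected (del_edges (edges G)).
Proof.
move=> G2; have /card_gt0P[v _] : 0 < #|G| by apply: ltnW.
have := cut_edges_disconnect _ (set1_neq0 v) (set1_neqT v G2).
apply: contra; rewrite /connected => /andP[-> /forallP c] /=.
apply/forallP=> x; apply/forallP=> y; move/forallP/(_ y): (c x).
apply: connect_sub => u w /= /andP[uw /negP nF]; case: nF.
by apply/imsetP; exists (u, w); rewrite ?inE.
Qed.

Lemma edge_connectivity_trivial : #|G| = 1 -> maximally_edge_connected G.
Proof.
move=> /eqP/fintype1P[x Gx].
have noadj u w : adj u w = false by rewrite (Gx u) (Gx w) adj_irr.
have e0 : edges G = set0.
  by apply/setP=> e; rewrite in_set0; apply/negP=> /imsetP[p]; rewrite inE noadj.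
have d0 : deg x = 0 by apply: eq_card0 => w; rewrite inE noadj.
apply: (@etrans _ _ 0).
  apply/eqP; rewrite -leqn0 /edge_connectivity e0 cards0.
  by elim/big_rec: _ => // F n _ n0; rewrite (leq_trans (geq_minr _ _)).
by apply/esym/eqP; rewrite -leqn0 -d0 min_deg_le.
Qed.
End Cuts.

(** * Small cuts of the square and the flipped cut *)

Section Square.
Local Open Scope nat_scope.
Variable G : sgraph.

Lemma adj_square (x y : G) : adj x y -> @adj (square G) x y.
Proof.
move=> xy; have xny : x != y by apply: contraTneq xy => ->; rewrite adj_irr.
apply/andP; split=> //.
apply/dist_leP; exists 1 => //; apply/existsP; exists [tuple y].
by rewrite /= xy eqxx.
Qed.

Lemma adj2_square (x y z : G) : adj x y -> adj y z -> x != z -> @adj (square G) x z.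
Proof.
move=> xy yz xz; apply/andP; split=> //.
apply/dist_leP; exists 2 => //; apply/existsP; exists [tuple y; z].
by rewrite /= xy yz eqxx.
Qed.

Variables (k : nat) (A : {set G}).
Hypotheses (Gk : edge_connected k G) (G2 : 1 < #|G|).
Hypotheses (A0 : A != set0) (AT : A != setT).
Hypothesis A_cut : #|crossing (square G) A| < min_deg (square G).

Let cross2 v := #|cross_nbrs (square G) A v|.
Let good : {set G} := [set v | k <= 2 * cross2 v].
Let flip : {set G} := [set v | k <= 2 * #|cross_nbrs G A v|].

Lemma cross_nbrs_square v : #|cross_nbrs G A v| <= cross2 v.
Proof.
apply/subset_leq_card/subsetP=> w; rewrite !inE => /andP[-> /adj_square vw] /=.
exact: vw.
Qed.

Lemma flip_good v : v \in flip -> v \in good.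
Proof. by have := cross_nbrs_square v; rewrite !inE; lia. Qed.

Lemma flip_or_good_cross v w :
  adj v w -> (v \in A) != (w \in A) -> (v \in good) || (w \in flip).
Proof.
move=> vw op; have := edge_connected_deg G k w Gk G2; rewrite (deg_split G A).
(* If [w] is not flipped, more than half of [k] neighbours of [w] lie on its own side, and [v] sees
   them across the cut through [w]. The strict inequality counts [w] itself. *)
suff: #|side_nbrs G A w| < cross2 v by rewrite !inE; lia.
have wn : w \notin side_nbrs G A w by rewrite inE adj_irr andbF.
have := cardsU1 w (side_nbrs G A w); rewrite wn add1n => <-.
apply/subset_leq_card/subsetP=> u; rewrite !inE => /orP[/eqP->|/andP[/eqP e wu]].
  by rewrite eq_sym op; apply: adj_square.
rewrite e eq_sym op; apply: (adj2_square _ w) => //.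
by apply: contraNneq op => ->; rewrite e.
Qed.

Lemma flip_good_side v w :
  adj v w -> (v \in A) = (w \in A) -> v \in flip -> w \in good.
Proof.
move=> vw sd; suff: #|cross_nbrs G A v| <= cross2 w by rewrite !inE; lia.
apply/subset_leq_card/subsetP=> u; rewrite !inE sd => /andP[op vu].
rewrite op; apply: (adj2_square _ v) => //; first by rewrite adj_sym.
by apply: contraNneq op => ->.
Qed.

Let S : {set G} := [set v | (v \in A) (+) (v \in flip)].

(** An edge crosses [S] in two cases. Either it crosses [A] and its ends are both flipped or both
    unflipped, the latter being settled by [flip_or_good_cross] in both directions; or it stays
    within a side of [A] and exactly one end is flipped, which is [flip_good_side]. *)
Lemma crossing_flip_good v w :
  adj v w -> (v \in S) != (w \in S) -> (v \in good) && (w \in good).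
Proof.
move=> vw; have wv : adj w v by rewrite adj_sym.
have := flip_good v; have := flip_good w.
have := flip_or_good_cross v w vw; have := flip_or_good_cross w v wv.
have := flip_good_side v w vw; have := flip_good_side w v wv.
rewrite ![_ \in S]inE.
case: (v \in A); case: (w \in A); case: (v \in flip); case: (w \in flip) => //=;
  case: (v \in good); case: (w \in good) => //=; by intuition.
Qed.

Lemma flip_nontrivial : 0 < k -> S != set0 /\ S != setT.
Proof.
move=> k0.
(* Since [k] is positive, a vertex without neighbours across keeps its side; one such vertex on each
   side of [A] makes [S] nontrivial. *)
have nflip v : cross2 v = 0 -> v \in flip = false.
  by have := cross_nbrs_square v; rewrite inE; lia.
have [v vA /nflip v0] := small_cut_deep_vertex (square G) A A0 A_cut.
have AC0 : ~: A != set0 by rewrite -(inj_eq (@setC_inj _)) setCK setC0.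
have AC_cut := A_cut; rewrite -(crossing_setC (square G)) in AC_cut.
have [w wA w0] := small_cut_deep_vertex (square G) (~: A) AC0 AC_cut.
have {}w0 : w \in flip = false.
  apply: nflip; rewrite -w0; apply: eq_card => u; rewrite !inE.
  by do 2 case: (_ \in A).
split; first by apply/set0Pn; exists v; rewrite inE v0 vA.
rewrite -subTset; apply/subsetPn; exists w => //; rewrite inE w0.
by move: wA; rewrite inE => /negPf ->.
Qed.

Lemma leq_good : 0 < k -> 4 * k <= #|good| ^ 2.
Proof.
move=> k0; have [S0 ST] := flip_nontrivial k0.
have := edge_connected_crossing G k S Gk S0 ST.
have : #|crossing G S| <= #|good :&: S| * #|good :\: S|.
  rewrite -cardsX; apply/subset_leq_card/subsetP=> -[v w].
  rewrite in_crossing => /and3P[vS wS vw].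
  have := crossing_flip_good v w vw; rewrite vS (negPf wS) => /(_ isT).
  by rewrite in_setX in_setI in_setD vS wS => /andP[-> ->].
move=> /[swap] /leq_trans/[apply] k_le; rewrite -(cardsID S good).
by apply: leq_trans (nat_AGM2 _ _); rewrite leq_mul2l.
Qed.

Lemma small_square_cut : k ^ 3 <= 4 * #|crossing (square G) A| ^ 2.
Proof.
have [->//|k0] := posnP k.
have lg := leq_good k0.
have : k * #|good| <= 4 * #|crossing (square G) A|.
  have le_c : \sum_(v in good) cross2 v <= 2 * #|crossing (square G) A|.
    by rewrite -sum_cross_nbrs [leqRHS](bigID (mem good)) leq_addr.
  suff: k * #|good| <= 2 * \sum_(v in good) cross2 v by lia.
  rewrite big_distrr /= mulnC -sum_nat_const.
  by apply: leq_sum => v; rewrite inE.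
(* Writing c for the size of the cut, the chain is [4 * k ^ 3 <= (k * #|good|) ^ 2 <= 16 * c ^ 2],
   hence the multiplication by 4. *)
rewrite -leq_sqr => sq_le; rewrite -(leq_pmul2l (isT : 0 < 4)).
apply: (@leq_trans ((k * #|good|) ^ 2)); last by rewrite mulnA -[4 * 4]/(4 ^ 2) -expnMn.
by rewrite expnMn (expnSr k 2) mulnCA leq_mul2l lg orbT.
Qed.
End Square.

(** * From single cuts to the edge-connectivity of the square *)

Lemma edge_connectivity_square (k : nat) (G : sgraph) :
  edge_connected k G -> (1 < #|G|)%N ->
  ((min_deg (square G) <= edge_connectivity (square G)) ||
   (k ^ 3 <= 4 * edge_connectivity (square G) ^ 2))%N.
Proof.
move=> Gk G2; pose K n := ((min_deg (square G) <= n) || (k ^ 3 <= 4 * n ^ 2))%N.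
have sq0 : (0 < #|square G|)%N by apply: ltnW.
have KF (F : {set {set square G}}) : ~~ connected (del_edges F) -> K #|F|.
  move=> /(disconnected_cut (square G) F sq0)[A [A0 AT le_F]]; rewrite /K.
  case: leqP => //= F_lt.
  have := small_square_cut G k A Gk G2 A0 AT (leq_ltn_trans le_F F_lt).
  by move=> cut_le; apply: leq_trans cut_le _; rewrite leq_mul2l leq_sqr.
(* [K] passes to the minimum of two numbers, so it only has to hold for the default value and for
   the size of each disconnecting set. *)
apply: (big_ind K) => [|m n Km Kn|F /andP[_ /KF]] //.
  exact/KF/edges_disconnect.
by rewrite /minn; case: ifP.
Qed.

Theorem theorem4 (R : realType) (lambda : nat) (G : sgraph)
    (G_conn : connected G) (G_edge_conn : edge_connected lambda G) :
  maximally_edge_connected (square G) \/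
  (edge_connectivity (square G))%:R >=
    1 / 2 * (lambda%:R `^ (3 / 2)) - 1 / 2 * lambda%:R :> R.
Proof.
have [G1|G2] : #|G| = 1%N \/ (1 < #|G|)%N by case/andP: G_conn => ? _; lia.
  by left; apply: edge_connectivity_trivial.
case/orP: (edge_connectivity_square lambda G G_edge_conn G2) => [ge_min|bound].
  left; apply/eqP; rewrite eqn_leq ge_min andbT.
  exact: edge_connectivity_le_min_deg.
right; set c := edge_connectivity _ in bound *.
have pow_sq : (lambda%:R `^ (3 / 2)) ^+ 2 = (lambda ^ 3)%:R :> R.
  by rewrite -powR_mulrn ?powR_ge0 // -powRrM mulfVK ?pnatr_eq0 // powR_mulrn // natrX.
(* This is the square root of [lambda ^ 3 <= 4 * c ^ 2], obtained by comparing squares of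
   nonnegative reals. *)
have pow_le : lambda%:R `^ (3 / 2) <= (2 * c)%:R :> R.
  rewrite -(ler_pXn2r (n := 2)) // ?nnegrE ?powR_ge0 ?ler0n //.
  by rewrite pow_sq -natrX ler_nat expnMn.
have : 0 <= lambda%:R :> R by rewrite ler0n.
by move: pow_le; rewrite natrM; lra.
Qed.
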